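(* Let $n\ge1$ and suppose the map $\mathcal M$ is injective on $\Omega$. If the polynomial $p(t)=\sum_{j=0}^{2n+1}b_{2n+1-j}t^j$ has $2n+1$ real roots (counting multiplicity) and at least two of its roots are nonzero, then for every $M\in\mathcal M(\Omega)$ the matrix $A(M)$ has $2n+1$ distinct real eigenvalues, i.e. the $n$-node EQMOM moment system $\partial_tM+A(M)\partial_xM=S(M)$ is strictly hyperbolic on $\mathcal M(\Omega)$.
   Context: Let $\mathcal K:\mathbb R\to[0,\infty)$ be a kernel with $\mathfrak m_j:=\int_{\mathbb R}\xi^j\mathcal K(\xi)\,d\xi<\infty$ for all $j$; the kernel is assumed normalized: $\mathfrak m_0=1$, $\mathfrak m_1=0$, $\mathfrak m_2=1$. Let $\Delta_j(u,\sigma)=\int\xi^j\frac1\sigma\mathcal K(\frac{\xi-u}{\sigma})d\xi=\sum_{k=0}^j\binom jk\mathfrak m_k\sigma^ku^{j-k}$. For $W=(w_1,u_1,\dots,w_n,u_n,\sigma)$, $\mathcal M(W)=(M_0,\dots,M_{2n})^T$ with $M_j=\sum_{i=1}^nw_i\Delta_j(u_i,\sigma)$. $\Omega=\{W: w_i>0\ \forall i,\ u_1<\dots<u_n,\ \sigma>0\}$. On $\mathcal M(\Omega)$ define the closure $\mathcal M_{2n+1}(M)=\sum_{i=1}^nw_i\Delta_{2n+1}(u_i,\sigma)$ where $W=\mathcal M^{-1}(M)$, and $a_j(M)=\partial\mathcal M_{2n+1}/\partial M_j$ for $j=0,\dots,2n$. $A(M)$ is the $(2n+1)\times(2n+1)$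 matrix with ones on the superdiagonal, last row $(a_0,a_1,\dots,a_{2n})$, and zeros elsewhere. The numbers $b_j$: $b_0=1$, $b_j=-\sum_{k=1}^j\frac{\mathfrak m_k}{k!}b_{j-k}$ for $j\ge1$. Strict hyperbolicity means $A(M)$ has $2n+1$ distinct real eigenvalues. *)

(* Defs.v *)
From HB Require Import structures.
From mathcomp Require Import all_boot all_order all_algebra.
From mathcomp Require Import all_classical all_reals all_analysis.
Unset Printing Implicit Defensive.
Import Order.TTheory GRing.Theory Num.Theory.
Import numFieldNormedType.Exports.
Local Open Scope classical_set_scope.
Local Open Scope ring_scope.

Section EQMOM.
Variable R : realType.

Definition kmoment (K : R -> R) (j : nat) : R :=
  Rintegral lebesgue_measure setT (fun x => x ^+ j * K x).

Definition is_kernel (K : R -> R) : Prop :=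
  (forall x, 0 <= K x) /\
  measurable_fun setT K /\
  (forall j : nat, lebesgue_measure.-integrable setT (fun x => (x ^+ j * K x)%:E)) /\
  kmoment K 0 = 1 /\ kmoment K 1 = 0 /\ kmoment K 2 = 1.

Definition Delta (m : nat -> R) (j : nat) (u sigma : R) : R :=
  \sum_(k < j.+1) ('C(j, k))%:R * m k * sigma ^+ k * u ^+ (j - k).

Definition Mvec (m : nat -> R) (n : nat) (w u : 'rV[R]_n) (sigma : R)
  : 'rV[R]_((n.*2).+1) :=
  \row_(j < (n.*2).+1) \sum_(i < n) w 0 i * Delta m j (u 0 i) sigma.

Definition inOmega (n : nat) (w u : 'rV[R]_n) (sigma : R) : Prop :=
  (forall i, 0 < w 0 i) /\ (forall i j : 'I_n, (i < j)%N -> u 0 i < u 0 j)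
  /\ 0 < sigma.

Definition Mimage (m : nat -> R) (n : nat) : set 'rV[R]_((n.*2).+1) :=
  [set M | exists (w u : 'rV[R]_n) (sigma : R), inOmega n w u sigma /\ Mvec m n w u sigma = M].

Definition Minjective (m : nat -> R) (n : nat) : Prop :=
  forall (w u w' u' : 'rV[R]_n) (sigma sigma' : R), inOmega n w u sigma -> inOmega n w' u' sigma' ->
    Mvec m n w u sigma = Mvec m n w' u' sigma' -> [/\ w = w', u = u' & sigma = sigma'].

(* closure M_{2n+1}(M) = sum_i w_i Delta_{2n+1}(u_i, sigma) with W = M^{-1}(M);
   the preimage is picked by classical choice; off M(Omega) the value is 0
   (irrelevant: only values on M(Omega) are used). *)
Definition closure_mom (m : nat -> R) (n : nat) (M : 'rV[R]_((n.*2).+1)) : R :=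
  match pselect (exists W : 'rV[R]_n * 'rV[R]_n * R,
                   inOmega n W.1.1 W.1.2 W.2 /\ Mvec m n W.1.1 W.1.2 W.2 = M) with
  | left h => let W := projT1 (cid h) in
      \sum_(i < n) W.1.1 0 i * Delta m (n.*2).+1 (W.1.2 0 i) W.2
  | right _ => 0
  end.

Definition Amat (n : nat) (a : 'rV[R]_((n.*2).+1)) : 'M[R]_((n.*2).+1) :=
  \matrix_(i < (n.*2).+1, j < (n.*2).+1)
     if (i < n.*2)%N then (j == i.+1 :> nat)%:R else a 0 j.

(* b_0 = 1, b_j = - sum_{k=1}^j m_k / k! b_{j-k} ; bs m j = [:: b_0; ...; b_j] *)
Fixpoint bs (m : nat -> R) (j : nat) : seq R :=
  match j with
  | 0 => [:: 1]
  | j'.+1 => let s := bs m j' in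
      rcons s (- \sum_(k < j'.+1) m k.+1 / (k.+1)`!%:R * nth 0 s (j' - k))
  end.
Definition bcoef (m : nat -> R) (j : nat) : R := nth 0 (bs m j) j.

Definition ppoly (m : nat -> R) (n : nat) : {poly R} :=
  \poly_(j < (n.*2).+2) bcoef m ((n.*2).+1 - j).

Definition strictly_hyperbolic (k : nat) (A : 'M[R]_k) : Prop :=
  exists s : seq R, [/\ uniq s, size s = k & all (eigenvalue A) s].

End EQMOM.

Arguments kmoment {R}.
Arguments is_kernel {R}.
Arguments Delta {R}.
Arguments Mvec {R} m n.
Arguments inOmega {R} n.
Arguments Mimage {R}.
Arguments Minjective {R}.
Arguments closure_mom {R}.
Arguments Amat {R} n.
Arguments bs {R}.
Arguments bcoef {R}.
Arguments ppoly {R}.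
Arguments strictly_hyperbolic {R} k.

(* Main.v *)
(* Write D = d/dX, let phi be the exponential generating series of the moments m_k and Q = 1/phi, so that b_0, b_1, ... are the coefficients of Q; the hypothesis on p says that Q = prod (1 - r X), up to irrelevant high order terms, over the real roots r of p. The i-th node sees a polynomial q through (phi(sigma D) q)(u_i).

   The characteristic polynomial of A is c = X^(2n+1) - sum_j a_j X^j, and the chain rule in the directions w_i and u_i says that g = phi(sigma D) c vanishes doubly at every node. Hence g = (X - v) prod (X - u_i)^2 is real-rooted with multiplicities at most 3, and c = prod (1 - r sigma D) g. Each 1 - r sigma D preserves real-rootedness and, if r <> 0, lowers multiplicities greater than 1; two nonzero r's therefore make the roots of c simple.

   The chain rule is legitimate although only the partial derivatives of the closure are given, because the Jacobian of the moment map is invertible: a polynomial q of degree at most 2n in its kernel has phi(sigma D) q = k H with H = prod (X - u_i)^2, and the sigma-derivative of the moments then gives k sum_(i, r) w_i y_r(u_i) = 0, where y_r - r sigma y_r' = H. Since H >= 0 forces y_r > 0 for r <> 0, k = 0. The moment map thus has a local right inverse with a linear approximation, which is all that is needed. *)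

Require Import Defs.
From HB Require Import structures.
From mathcomp Require Import all_boot all_order all_algebra.
From mathcomp Require Import all_classical all_reals all_analysis.
From mathcomp Require Import complex polyrcf ring lra.
Set Implicit Arguments.
Unset Strict Implicit.
Unset Printing Implicit Defensive.
Import Order.TTheory GRing.Theory Num.Theory.
Import numFieldNormedType.Exports.
Local Open Scope ring_scope.

(** * Real-rooted polynomials and the operator 1 - r D *)

Lemma prod_XsubC_deriv_log (F : fieldType) (s : seq F) (z : F) :
  (\prod_(x <- s) ('X - x%:P)).[z] != 0 ->
  (\prod_(x <- s) ('X - x%:P))^`().[z]
    = (\prod_(x <- s) ('X - x%:P)).[z] * \sum_(x <- s) (z - x)^-1.
Proof.
elim: s => [|x s IH]; first by rewrite !big_nil -polyC1 derivC mulr0 horner0.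
rewrite !big_cons derivM derivXsubC mul1r !hornerE mulf_eq0 => /norP[nz0 nz1].
by rewrite IH //; field.
Qed.

Lemma Im_inv_subr_real (C : numClosedFieldType) (z x : C) :
  x \is Num.real -> 'Im z != 0 -> 'Im z * 'Im ((z - x)^-1) < 0.
Proof.
move=> xR zI.
have zxI : 'Im (z - x) = 'Im z by rewrite raddfB /= (Creal_ImP _ xR) subr0.
have nz : z - x != 0 by apply: contraNneq zI => e; rewrite -zxI e raddf0.
have -> : (z - x)^-1 = ((`|z - x| ^+ 2)^-1) * (z - x)^*.
  by rewrite normCK invfM -mulrA mulVf ?conjC_eq0 // mulr1.
rewrite ImMl; last by rewrite realV realX // normr_real.
rewrite Im_conj zxI mulrCA pmulr_rlt0 ?invr_gt0 ?exprn_gt0 ?normr_gt0 //.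
rewrite mulrN oppr_lt0 -expr2 lt_def sqrf_eq0 zI /=.
by rewrite real_exprn_even_ge0 // Creal_Im.
Qed.

(** Off the roots of [g] the equation reads [1 = r * \sum (z - x)^-1]. For non-real [z] every term
    has an imaginary part of sign opposite to ['Im z], so the sum cannot be the real number
    [r^-1]. *)
Lemma sub_deriv_root_real (C : numClosedFieldType) (s : seq C) (r z : C) :
  r \is Num.real -> all (fun x => x \is Num.real) s ->
  let g := \prod_(x <- s) ('X - x%:P) in
  root (g - r *: g^`()) z -> z \is Num.real.
Proof.
move=> rR sR g; have [gz _|gz] := eqVneq g.[z] 0.
  have : root g z by apply/rootP.
  by rewrite root_prod_XsubC => /(allP sR).
rewrite rootE !hornerE prod_XsubC_deriv_log // -/g mulrCA -[X in X - _]mulr1 -mulrBr mulf_eq0.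
rewrite (negPf gz) /= subr_eq0 => /eqP e.
have rnz : r != 0 by apply: contra_eqN e => /eqP->; rewrite mul0r oner_eq0.
case: s @g sR gz e => [|x s] g sR gz e.
  by move/eqP: e; rewrite big_nil mulr0 oner_eq0.
apply/Creal_ImP/eqP; apply: contraT => zI; exfalso.
have eR : \sum_(x <- x :: s) (z - x)^-1 = r^-1.
  by apply: (mulfI rnz); rewrite -e divff.
have /Creal_ImP eI : r^-1 \is Num.real by rewrite realV.
have H0 : 'Im z * 'Im (\sum_(y <- x :: s) (z - y)^-1) = 0 by rewrite eR eI mulr0.
move: (sR) => /= /andP[xR sR'].
have : 'Im z * 'Im (\sum_(y <- x :: s) (z - y)^-1) < 0.
  rewrite big_cons raddfD mulrDr /=; apply: ltr_wnDr; last exact: Im_inv_subr_real.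
  rewrite raddf_sum mulr_sumr big_seq; apply: sumr_le0 => y ys /=.
  by apply/ltW/Im_inv_subr_real => //; exact: (allP sR').
by rewrite H0 ltxx.
Qed.

(** Multiplicities are repetitions in [s]; only monic polynomials qualify. *)
Definition splits {R : fieldType} (g : {poly R}) :=
  exists s, g = \prod_(x <- s) ('X - x%:P).

(** Over [R[i]] the polynomial splits; its roots are real by [sub_deriv_root_real], so the
    factorization descends to [R]. *)
Lemma splits_sub_deriv (R : rcfType) (g : {poly R}) (r : R) :
  splits g -> splits (g - r *: g^`()).
Proof.
case=> s gE; pose f := g - r *: g^`().
have gm : g \is monic by rewrite gE monic_prod_XsubC.
have fm : f \is monic.
  apply/monicP; rewrite /f -scaleNr lead_coefDl ?(monicP gm) //.
  apply: leq_ltn_trans (size_scale_leq _ _) _; exact: lt_size_deriv (monic_neq0 gm).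
pose F := map_poly (real_complex R) f.
have Fm : F \is monic by rewrite /F map_monic.
have [t tE] := closed_field_poly_normal F.
have Fr z : z \in t -> z \is Num.real.
  move=> zt; apply: (@sub_deriv_root_real R[i] (map (real_complex R) s) (r%:C)%C).
  - by rewrite complex_real.
  - by apply/allP => _ /mapP[x _ ->]; rewrite complex_real.
  have -> : \prod_(x <- [seq (x%:C)%C | x <- s]) ('X - x%:P) = map_poly (real_complex R) g.
    rewrite gE big_map rmorph_prod; apply: eq_bigr => x _.
    by rewrite /= map_polyXsubC.
  have -> : map_poly (real_complex R) g
      - (r%:C)%C *: (map_poly (real_complex R) g)^`() = F.
    by rewrite /F /f rmorphB /= map_polyZ deriv_map.
  by rewrite tE (monicP Fm) scale1r root_prod_XsubC.
exists (map (@complex.Re R) t); apply: (map_poly_inj (real_complex R)).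
rewrite -/F tE (monicP Fm) scale1r big_map rmorph_prod big_seq [RHS]big_seq.
apply: eq_bigr => z zt; rewrite /= map_polyXsubC; congr ('X - _%:P).
by have /complex_realP[k ->] := Fr z zt.
Qed.

(** By induction: passing from [g] to [(X - y) g] turns [g'^2 - g g''] into
    [(x - y)^2 (g'^2 - g g'') + g^2]. *)
Lemma prod_XsubC_laguerre (R : realDomainType) (s : seq R) (x : R) :
  let g := \prod_(y <- s) ('X - y%:P) in
  g.[x] != 0 -> s != [::] -> g.[x] * g^`()^`().[x] < g^`().[x] ^+ 2.
Proof.
case: s => // y s g + _; rewrite {}/g; elim: s y => [|y' s IH] y.
  by rewrite big_seq1 derivXsubC -polyC1 derivC horner0 mulr0 hornerC expr1n ltr01.
rewrite big_cons; set g := \prod_(_ <- _ :: _) _ => nz.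
have gz : g.[x] != 0 by apply: contraNneq nz; rewrite hornerM => ->; rewrite mulr0.
move: {IH}(IH y' gz); rewrite -/g => IH.
have yz : x - y != 0 by apply: contraNneq nz; rewrite hornerM !hornerE => ->; rewrite mul0r.
rewrite derivM derivXsubC mul1r derivD derivM derivXsubC mul1r !hornerE.
have H1 : 0 < (x - y)^+2 by rewrite exprn_even_gt0.
have H2 : 0 < g.[x] ^+2 by rewrite exprn_even_gt0.
rewrite -subr_gt0; move: IH; rewrite -subr_gt0 => IH.
have := addr_gt0 (mulr_gt0 H1 IH) H2; congr (_ < _) => /=; ring.
Qed.

(* The new roots of [g - r g'] are simple and every multiplicity of an old one drops by one. *)
Lemma dvdp_sub_deriv (R : realFieldType) (s : seq R) (r x : R) (j : nat) :
  r != 0 -> (0 < j)%N ->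
  let g := \prod_(y <- s) ('X - y%:P) in
  ('X - x%:P) ^+ j.+1 %| g - r *: g^`() -> ('X - x%:P) ^+ j.+2 %| g.
Proof.
move=> rnz j0 g dv.
have gnz : g != 0 by rewrite /g monic_neq0 // monic_prod_XsubC.
have [m [q /implyP/(_ gnz) qx gE]] := multiplicity_XsubC g x.
(* If [x] is not a root of [g], a double root of [g - r g'] there gives [g = r g'] and [g' = r g''],
   hence [g g'' = g'^2], against [prod_XsubC_laguerre]. *)
have [m0|m0] := posnP m.
  have gx : g.[x] != 0 by rewrite gE m0 expr0 mulr1 -rootE.
  case: j j0 dv => // j _ /dvdpP[k kE].
  have f0 : (g - r *: g^`()).[x] = 0 by rewrite kE exprS mulrA !hornerM hornerXsubC subrr mulr0 mul0r.
  have f1 : (g - r *: g^`())^`().[x] = 0.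
    rewrite kE !exprS !derivM derivXsubC !(hornerM, hornerXsubC, hornerD) subrr /=.
    by rewrite !(mulr0, mul0r, addr0).
  have snz : s != [::].
    apply: contraNneq gx => s0; move: f0.
    by rewrite /g s0 big_nil -polyC1 derivC scaler0 subr0 => ->.
  have := @prod_XsubC_laguerre R s x gx snz; rewrite -/g.
  move: f0 f1; rewrite derivB derivZ !hornerE => /eqP; rewrite subr_eq0 => /eqP e0.
  move=> /eqP; rewrite subr_eq0 => /eqP e1.
  suff -> : g.[x] * g^`()^`().[x] = g^`().[x] ^+ 2 by rewrite ltxx.
  by rewrite e0 expr2 {3}e1; ring.
case: m gE m0 => // m gE _.
(* Cofactor of [(X - x)^m] in [g - r g']; its value at [x] is [- r (m + 1) q(x)], which is
   nonzero. *)
pose b := q * ('X - x%:P) - r *: (q^`() * ('X - x%:P) + q *+ m.+1).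
have bx : ~~ root b x.
  rewrite rootE /b !hornerE subrr !mulr0 !add0r oppr_eq0 !mulf_neq0 //.
  by rewrite hornerMn mulrn_eq0 negb_or.
have fE : g - r *: g^`() = b * ('X - x%:P) ^+ m.
    by rewrite gE derivM deriv_exp derivXsubC mul1r /b /= exprS mulrnAr
    -mulrnAl [in RHS]mulrBl -scalerAl [in RHS]mulrDl !mulrA.
have lt_jm : (j < m)%N.
  rewrite ltnNge; apply: contra bx => le_mj.
  rewrite -dvdp_XsubCl -(@dvdp_mul2r _ (('X - x%:P) ^+ m)).
    by rewrite -fE -exprS (dvdp_trans _ dv) // dvdp_exp2l.
  by rewrite expf_neq0 // polyXsubC_eq0.
by rewrite gE dvdp_mull // dvdp_exp2l.
Qed.

(** New simple roots may appear, so for [r != 0] the bound on the multiplicities drops by one but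
    never below 1. *)
Lemma not_dvdp_sub_deriv (R : rcfType) (g : {poly R}) (r : R) (k : nat) :
  splits g -> (forall x, ~~ (('X - x%:P) ^+ k.+1 %| g)) ->
  forall x, ~~ (('X - x%:P) ^+ (if r == 0 then k else maxn 1 k.-1).+1 %| g - r *: g^`()).
Proof.
case=> s -> Hk x; have [->|rnz] := eqVneq r 0; first by rewrite scale0r subr0.
apply: contra (Hk x) => /dvdp_sub_deriv dv.
have {}dv := dv rnz (leq_maxl _ _).
apply: dvdp_trans dv; apply: dvdp_exp2l; rewrite ltnS.
by case: k {Hk} => // k; exact: leq_trans (leq_maxr 1 k) _.
Qed.

(** * Constant-coefficient differential operators *)

(** This is [phi(D)] with [D = d/dX]; products of symbols act as compositions ([dopM]). *)
Definition dop {R : nzRingType} (phi q : {poly R}) : {poly R} :=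
  \sum_(k < size phi) phi`_k *: q^`(k).

Section Dop.
Variable R : comNzRingType.
Implicit Types (phi psi p q : {poly R}).

Lemma dopE n phi q : (size phi <= n)%N -> dop phi q = \sum_(k < n) phi`_k *: q^`(k).
Proof.
move=> le_n; rewrite /dop (big_ord_widen n (fun k => phi`_k *: q^`(k))) // big_mkcond.
apply: eq_bigr => k _; case: ltnP => // le_k.
by rewrite nth_default // scale0r.
Qed.

Lemma dopDl phi psi q : dop (phi + psi) q = dop phi q + dop psi q.
Proof.
rewrite !(@dopE (maxn (size phi) (size psi))) ?leq_maxl ?leq_maxr ?size_polyD //.
by rewrite -big_split; apply: eq_bigr => k _ /=; rewrite coefD scalerDl.
Qed.

Lemma dopZl c phi q : dop (c *: phi) q = c *: dop phi q.
Proof.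
rewrite !(@dopE (size phi)) ?size_scale_leq // scaler_sumr.
by apply: eq_bigr => k _; rewrite coefZ scalerA.
Qed.

Lemma dopNl phi q : dop (- phi) q = - dop phi q.
Proof. by rewrite -scaleN1r dopZl scaleN1r. Qed.

Lemma dop0l q : dop 0 q = 0.
Proof. by rewrite /dop size_poly0 big_ord0. Qed.

Lemma dopC c q : dop c%:P q = c *: q.
Proof. by rewrite (@dopE 1) ?size_polyC_leq1 // big_ord1 coefC. Qed.

Lemma dop1 q : dop 1 q = q.
Proof. by rewrite -polyC1 dopC scale1r. Qed.

Lemma dopDr phi p q : dop phi (p + q) = dop phi p + dop phi q.
Proof.
by rewrite /dop -big_split; apply: eq_bigr => k _; rewrite derivnD scalerDr.
Qed.

Lemma dopZr phi c q : dop phi (c *: q) = c *: dop phi q.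
Proof.
rewrite /dop scaler_sumr; apply: eq_bigr => k _.
by rewrite derivnZ !scalerA mulrC.
Qed.

Lemma dopMX phi q : dop (phi * 'X) q = dop phi q^`().
Proof.
rewrite (@dopE (size phi).+1) ?size_polyMX_leq ?(leq_trans (size_polyMleq _ _)) //; last first.
  by rewrite size_polyX addn2.
rewrite big_ord_recl coefMX /= scale0r add0r; apply: eq_bigr => k _.
by rewrite coefMX -derivnS derivSn.
Qed.

Lemma deriv_dop phi q : (dop phi q)^`() = dop phi q^`().
Proof.
rewrite /dop raddf_sum; apply: eq_bigr => k _ /=.
by rewrite derivZ -derivnS derivSn.
Qed.

Lemma dopM phi psi q : dop (phi * psi) q = dop phi (dop psi q).
Proof.
elim/poly_ind: phi psi q => [|phi c IH] psi q; first by rewrite mul0r !dop0l.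
rewrite mulrDl !dopDl mul_polyC dopZl dopC; congr (_ + _).
by rewrite mulrAC !dopMX deriv_dop IH.
Qed.

Lemma dopXn m q : dop 'X^m q = q^`(m).
Proof.
elim: m q => [|m IH] q; first by rewrite dop1.
by rewrite exprSr dopMX IH derivSn.
Qed.

(** [D^m] kills polynomials of degree below [m], so symbols matter only modulo ['X^m] and power
    series can be truncated. *)
Lemma dop_Xn_mul m psi q : (size q <= m)%N -> dop (psi * 'X^m) q = 0.
Proof.
move=> le_m; rewrite dopM dopXn derivn_poly0 // /dop big1 // => k _.
by rewrite linear0 scaler0.
Qed.

Lemma dop_1subX r q : dop (1 - r *: 'X) q = q - r *: q^`().
Proof. by rewrite dopDl dopNl dopZl dop1 -['X]mul1r dopMX dop1. Qed.

End Dop.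

(** The multiplicities are at most [k + 1] at the start; truncated subtraction stops the bound at
    1. *)
Lemma dop_prod_simple_roots (R : rcfType) (rs : seq R) (g : {poly R}) (k : nat) :
  splits g -> (forall x, ~~ (('X - x%:P) ^+ k.+2 %| g)) ->
  let f := dop (\prod_(r <- rs) (1 - r *: 'X)) g in
  splits f /\
  (forall x, ~~ (('X - x%:P) ^+ (k - count (fun r => r != 0) rs).+2 %| f)).
Proof.
move=> sg Hg; elim: rs => [|r rs [IH1 IH2]] /=.
  by rewrite big_nil dop1 subn0.
rewrite big_cons dopM dop_1subX; split; first exact: splits_sub_deriv.
move=> x; have := not_dvdp_sub_deriv r IH1 IH2 x.
have [->|rnz] := eqVneq r 0 => //=.
by rewrite add1n subnS maxnE; case: (k - _)%N => [|[]].
Qed.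

Lemma splits_uniq (R : fieldType) (f : {poly R}) :
  splits f -> (forall x, ~~ (('X - x%:P) ^+ 2 %| f)) ->
  exists2 s, uniq s & f = \prod_(x <- s) ('X - x%:P).
Proof.
case=> s -> H; exists s => //; elim: s H => //= x s IH H; apply/andP; split.
  apply: contra (H x) => xs; rewrite big_cons exprS expr1 dvdp_mul //.
  by rewrite dvdp_XsubCl root_prod_XsubC.
apply: IH => y; apply: contra (H y) => dv.
by rewrite big_cons dvdp_mull.
Qed.

(** * Truncated inverses and positivity *)

Lemma dopK (R : comNzRingType) (phi psi q rem : {poly R}) (m : nat) :
  phi * psi = 1 + rem * 'X^m -> (size q <= m)%N -> dop phi (dop psi q) = q.
Proof. by move=> e le_m; rewrite -dopM e dopDl dop1 dop_Xn_mul // addr0. Qed.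

Lemma lead_coef_gt0_ge0 (R : rcfType) (h : {poly R}) :
  h != 0 -> (forall x, 0 <= h.[x]) -> 0 < lead_coef h.
Proof.
move=> hnz h0; rewrite ltNge le_eqVlt lead_coef_eq0 (negPf hnz) /=.
apply/negP => neg; have := @poly_pinfty_gt_lc R (- h).
rewrite lead_coefN oppr_gt0 => /(_ neg)[b /(_ b (lexx b))].
by rewrite hornerN lerN2 => /le_lt_trans/(_ neg); rewrite ltNge h0.
Qed.

Lemma lead_coef_sub_deriv (R : idomainType) (y : {poly R}) (r : R) :
  lead_coef (y - r *: y^`()) = lead_coef y.
Proof.
have [->|ynz] := eqVneq y 0; first by rewrite deriv0 scaler0 subr0.
rewrite -scaleNr lead_coefDl //.
by apply: leq_ltn_trans (size_scale_leq _ _) _; exact: lt_size_deriv.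
Qed.

(* [expR (- x / r) * y.[x]] has derivative [- expR (- x / r) * (y - r y').[x] / r <= 0]. *)
Lemma sub_deriv_gt0_pos (R : realType) (y : {poly R}) (r u : R) :
  0 < r -> y - r *: y^`() != 0 -> (forall x, 0 <= (y - r *: y^`()).[x]) ->
  0 < y.[u].
Proof.
move=> r0 hnz h0; rewrite ltNge; apply/negP => yu.
have := lead_coef_gt0_ge0 hnz h0; rewrite lead_coef_sub_deriv => lc0.
have [b Hb] := poly_pinfty_gt_lc lc0.
have [P dP] : exists P : {poly R}, forall x, P^`().[x] = - r^-1.
  by exists (- r^-1 *: 'X) => x; rewrite derivZ derivX !hornerE.
pose G : R -> R := (expR \o horner P) * horner y.
have dG (x : R) : is_derive x (1 : R) G (- (expR P.[x] * (y - r *: y^`()).[x] / r)).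
  apply: is_derive_eq; rewrite dP !hornerE /GRing.scale /=.
  by move: (expR _) => E; field; rewrite gt_eqF.
have cG : continuous G.
  by move=> x; apply/differentiable_continuous/derivable1_diffP; have [] := dG x.
(* [G] does not increase to the right of [u], where [y(u) <= 0] makes it nonpositive, yet the
   positive leading coefficient of [y] makes it positive far to the right. *)
have : G (Num.max u b) <= G u.
  apply: (@ler0_derive1_nincry R G u); rewrite ?le_max ?lexx //.
  - move=> x _; rewrite derive1E; have [_ ->] := dG x.
    by rewrite oppr_le0 !mulr_ge0 ?expR_ge0 ?invr_ge0 // ltW.
  - exact: continuous_subspaceT.
apply/negP; rewrite -ltNge; apply: (@le_lt_trans _ _ 0).
  by rewrite /G /= mulr_ge0_le0 // expR_ge0.
rewrite /G /= mulr_gt0 ?expR_gt0 //; apply: lt_le_trans lc0 _; apply: Hb.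
by rewrite le_max lexx orbT.
Qed.

(** The reflection [X -> -X] changes the sign of [r], which reduces [r < 0] to the positive case. *)
Lemma sub_deriv_gt0 (R : realType) (y : {poly R}) (r u : R) :
  r != 0 -> y - r *: y^`() != 0 -> (forall x, 0 <= (y - r *: y^`()).[x]) ->
  0 < y.[u].
Proof.
wlog r0 : y r u / 0 < r => [Hw|] rnz hnz h0.
  have [r0|r0] := ltP 0 r; first exact: Hw r0 rnz hnz h0.
  have E : (y \Po - 'X) - (- r) *: (y \Po - 'X)^`() = (y - r *: y^`()) \Po - 'X.
    by rewrite deriv_comp derivN derivX mulrN1 scaleNr opprK scalerN comp_polyB comp_polyZ.
  have := Hw (y \Po - 'X) (- r) (- u); rewrite E horner_comp !hornerE opprK.
  apply => //.
  - by rewrite oppr_gt0 lt_neqAle rnz.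
  - by rewrite oppr_eq0.
  - by rewrite comp_poly_eq0 // size_polyN size_polyX.
  - by move=> x; rewrite horner_comp.
exact: sub_deriv_gt0_pos r0 hnz h0.
Qed.

(* For [r != 0] the polynomial [y := dop (phi * Q1) h], where [Q = (1 - r X) Q1],
   solves [y - r y' = h]; it is positive, so at a zero [u] of [h] one gets
   [r y'(u) = y(u) > 0]. *)
Lemma dop_log_deriv_ge0 (R : realType) (rs : seq R) (phi h : {poly R}) (m : nat) (u : R) :
  let Q := \prod_(r <- rs) (1 - r *: 'X) in
  (exists rem, phi * Q = 1 + rem * 'X^m) -> (size h <= m)%N ->
  h != 0 -> (forall x, 0 <= h.[x]) -> h.[u] = 0 ->
  0 <= (dop (- (phi * 'X * Q^`())) h).[u] ?= iff ~~ has (fun r => r != 0) rs.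
Proof.
move=> Q He le_m hnz h0 hu; rewrite {}/Q in He *.
elim: rs phi He => [|r rs IH] phi [rem].
  by rewrite big_nil -polyC1 derivC mulr0 oppr0 dop0l horner0 => _; exact/leif_refl. 
rewrite big_cons; set Q := \prod_(_ <- _) _ in IH * => e.
(* The factor [1 - r X] is moved from [Q] into [phi], which leaves their product unchanged. *)
have IH' : _ := IH (phi * (1 - r *: 'X)) (ex_intro _ rem _).
have {IH'}[|IH1 IH2] := IH'; first by rewrite -mulrA.
pose y := dop (phi * Q) h.
have yE : y - r *: y^`() = h.
  by rewrite -dop_1subX -dopM mulrCA e dopDl dop1 dop_Xn_mul // addr0.
(* Leibniz rule: the factor [1 - r X] contributes [r y'(u)], the other factors give the term of the
   induction hypothesis. *)
have -> : (dop (- (phi * 'X * ((1 - r *: 'X) * Q)^`())) h).[u]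
   = r * y^`().[u] + (dop (- (phi * (1 - r *: 'X) * 'X * Q^`())) h).[u].
  have -> : - (phi * 'X * ((1 - r *: 'X) * Q)^`())
     = r *: (phi * Q * 'X) - (phi * (1 - r *: 'X) * 'X * Q^`()).
    rewrite derivM derivB derivZ derivX -polyC1 derivC -!mul_polyC; ring.
  by rewrite dopDl hornerD dopZl dopMX hornerZ deriv_dop.
have yu : r * y^`().[u] = y.[u].
  by apply/esym/eqP; rewrite -subr_eq0 -hornerZ -hornerN -hornerD yE hu.
have [r0|rnz] := eqVneq r 0.
  by rewrite [X in ~~ X]/= {1 3}r0 eqxx mul0r add0r; split.
rewrite /= rnz /=.

have y_gt0 : 0 < y.[u] by apply: (@sub_deriv_gt0 _ _ r); rewrite ?yE.
rewrite yu; have H := ltr_wpDr IH1 y_gt0.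
by split; [exact: ltW | rewrite lt_eqF].
Qed.

(** The factor ['X] makes up for the power lost in differentiation, so a remainder modulo ['X^m]
    remains one. *)
Lemma deriv_mulXn (R : comNzRingType) (rem : {poly R}) (m : nat) :
  'X * (rem * 'X^m)^`() = ('X * rem^`() + rem *+ m) * 'X^m.
Proof.
rewrite derivM derivXn mulrDr mulrDl mulrA; congr (_ + _).
case: m => [|m] /=; first by rewrite !mulr0n mulr0 mul0r mulr0.
by rewrite !mulrnAr mulrnAl exprS mulrCA.
Qed.

Lemma size_dop (R : comNzRingType) (phi q : {poly R}) : (size (dop phi q) <= size q)%N.
Proof.
apply: (leq_trans (size_sum _ _ _)); apply/bigmax_leqP => k _.
apply: (leq_trans (size_scale_leq _ _)).
elim: (val k) => [|j IH] //; rewrite derivnS.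
exact: leq_trans (leq_trans (size_poly _ _) (leq_pred _)) IH.
Qed.

(** Differentiating [phi Q = 1] gives [X phi' Q = - phi X Q'], both modulo ['X^m]; this acts on
    [phi(D) q], from which [Q(D)] recovers [q]. *)
Lemma dop_logderiv (R : comNzRingType) (phi Q rem q : {poly R}) (m : nat) :
  phi * Q = 1 + rem * 'X^m -> (size q <= m)%N ->
  dop ('X * phi^`()) q = dop (- (phi * 'X * Q^`())) (dop phi q).
Proof.
move=> e le_m.
rewrite -[q in LHS](dopK _ le_m (phi := Q) (psi := phi) (rem := rem)); last by rewrite mulrC.
rewrite -dopM.
have -> : 'X * phi^`() * Q = - (phi * 'X * Q^`()) + ('X * rem^`() + rem *+ m) * 'X^m.
  have := congr1 deriv e; rewrite derivM derivD -polyC1 derivC add0r => e'.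
  by rewrite -deriv_mulXn -e'; ring.
rewrite dopDl [X in _ + X]dop_Xn_mul ?addr0 //.
exact: leq_trans (size_dop _ _) le_m.
Qed.

(** * The Jacobian of the moment map *)

Lemma size_bs (R : realType) (m : nat -> R) j : size (bs m j) = j.+1.
Proof. by elim: j => //= j IH; rewrite size_rcons IH. Qed.

Lemma nth_bs (R : realType) (m : nat -> R) j i : (i <= j)%N -> nth 0 (bs m j) i = bcoef m i.
Proof.
elim: j => [|j IH]; first by rewrite leqn0 => /eqP ->.
rewrite leq_eqVlt => /orP[/eqP -> //|lt_ij].
by rewrite /= nth_rcons size_bs lt_ij IH.
Qed.

Lemma bcoefS (R : realType) (m : nat -> R) j :
  bcoef m j.+1 = - \sum_(k < j.+1) m k.+1 / (k.+1)`!%:R * bcoef m (j - k).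
Proof.
rewrite /bcoef /= nth_rcons size_bs ltnn eqxx; congr (- _).
by apply: eq_bigr => k _; rewrite nth_bs // leq_subr.
Qed.

(* [dop (momop m l s) q] is the average of [q(X + s xi)] over the kernel, if [size q <= l]. *)
Definition momop {R : realType} (m : nat -> R) (l : nat) (s : R) : {poly R} :=
  \poly_(k < l) (m k * s ^+ k / k`!%:R).

(** The recursion for [bcoef] is the vanishing of the Cauchy product in degrees 1 to [l]; the powers
    of [s] factor out. *)
Lemma momop_mul_bcoef (R : realType) (m : nat -> R) (l : nat) (s : R) :
  m 0 = 1 ->
  exists rem, momop m l.+1 s * (\poly_(k < l.+1) (bcoef m k * s ^+ k)) = 1 + rem * 'X^(l.+1).
Proof.
move=> m0; set P := _ * _; exists (drop_poly l.+1 P).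
rewrite -[LHS](poly_take_drop l.+1); congr (_ + _).
apply/polyP => i; rewrite coef_take_poly coef1; case: ltnP => [lt_i|]; last by case: i.
rewrite /P coefM; under eq_bigr => j _.
  have lt_j : (j < l.+1)%N by apply: leq_ltn_trans lt_i; rewrite -ltnS.
  have lt_ij : (i - j < l.+1)%N by apply: leq_ltn_trans (leq_subr _ _) lt_i.
  rewrite !coef_poly lt_j lt_ij; over.
case: i lt_i => [|i] lt_i /=.
  by rewrite big_ord1 /= m0 fact0 invr1 subn0 /bcoef /= expr0 !mulr1.
rewrite big_ord_recl /= m0 expr0 mul1r fact0 invr1 !mul1r subn0 bcoefS.
apply/eqP; rewrite mulNr addrC subr_eq0 big_distrl /=; apply/eqP/eq_bigr => k _.
rewrite /bump /= add1n subSS.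
have -> : s ^+ i.+1 = s ^+ k.+1 * s ^+ (i - k).
  by rewrite -exprD addSn subnKC // -ltnS.
by ring.
Qed.

Lemma size_prod_1subX (R : nzRingType) (rs : seq R) (s : R) :
  (size (\prod_(r <- rs) (1 - (r * s) *: 'X))%R <= (size rs).+1)%N.
Proof.
elim: rs => [|r rs IH]; first by rewrite big_nil size_poly1.
rewrite big_cons; apply: leq_trans (size_polyMleq _ _) _.
have : (size (1 - (r * s) *: 'X)%R <= 2)%N.
  apply: leq_trans (size_polyD _ _) _; rewrite size_polyN size_poly1 geq_max /=.
  by apply: leq_trans (size_scale_leq _ _) _; rewrite size_polyX.
by move=> Hb; rewrite -subn1 leq_subLR (leq_trans (leq_add Hb IH)).
Qed.

(* The left-hand product is the reversal of [\prod_(r <- rs) ('X - r)], rescaled by [s]. *)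
Lemma coef_prod_1subX (R : comNzRingType) (rs : seq R) (s : R) (k : nat) :
  (k <= size rs)%N ->
  (\prod_(r <- rs) (1 - (r * s) *: 'X))`_k
    = (\prod_(r <- rs) ('X - r%:P))`_(size rs - k) * s ^+ k.
Proof.
elim: rs k => [|r rs IH] k; first by rewrite leqn0 => /eqP ->; rewrite !big_nil mulr1.
rewrite !big_cons !mulrBl mul1r -scalerAl !coefB coefZ coefXM coefXM coefCM /=.
case: k => [|k] le_k.
  rewrite mulr0 subr0 subn0 expr0 mulr1 /= IH // subn0 expr0 mulr1.
  rewrite [X in _ - r * X]nth_default ?mulr0 ?subr0 //.
  by rewrite size_prod_XsubC.
rewrite /= subSS (IH k) //.
move: le_k; rewrite ltnS leq_eqVlt => /orP[/eqP k_eq|lt_k].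
  rewrite k_eq subnn /= nth_default ?size_prod_1subX // exprS; ring.
rewrite IH // subn_eq0 leqNgt lt_k /= -subnS exprS; ring.
Qed.

(** [ppoly] lists the [bcoef] backwards, which undoes the reversal in [coef_prod_1subX]. *)
Lemma prod_1subX_bcoef (R : realType) (m : nat -> R) (n : nat) (rs : seq R) (s : R) :
  size rs = (n.*2).+1 -> ppoly m n = \prod_(r <- rs) ('X - r%:P) ->
  \prod_(r <- rs) (1 - (r * s) *: 'X) = \poly_(k < (n.*2).+2) (bcoef m k * s ^+ k).
Proof.
move=> sz e; apply/polyP => k; rewrite coef_poly; case: ltnP => lt_k.
  rewrite coef_prod_1subX ?sz // -e coef_poly ltnS leq_subr subKn //.
by rewrite nth_default // (leq_trans (size_prod_1subX _ _)) // sz.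
Qed.

(** For [f k = m k * s ^+ k], evaluation at [u] gives [Delta m j u s]. *)
Lemma dop_poly_Xn (R : realFieldType) (f : nat -> R) (l j : nat) : (j < l)%N ->
  dop (\poly_(k < l) (f k / k`!%:R)) 'X^j
    = \sum_(k < j.+1) ('C(j, k)%:R * f k) *: 'X^(j - k).
Proof.
move=> lt_j; rewrite (@dopE _ l) ?size_poly // (big_ord_widen l
  (fun k => ('C(j, k)%:R * f k) *: 'X^(j - k))) // [RHS]big_mkcond.
apply: eq_bigr => k _; rewrite coef_poly ltn_ord derivnXn; case: ltnP => le_k; last first.
  by rewrite ffact_small // mulr0n scaler0.
rewrite -['X^_ *+ _]scaler_nat scalerA -bin_ffact natrM; congr (_ *: _).
by field; rewrite pnatr_eq0 -lt0n fact_gt0.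
Qed.

Lemma dvdp_sqr_XsubC (R : fieldType) (h : {poly R}) (x : R) :
  h.[x] = 0 -> h^`().[x] = 0 -> ('X - x%:P) ^+ 2 %| h.
Proof.
move=> /rootP/factor_theorem[k ->]; rewrite derivM derivXsubC !hornerE subrr mulr0 add0r => kx.
by rewrite expr2 dvdp_mul2r ?polyXsubC_eq0 // dvdp_XsubCl; apply/rootP.
Qed.

Lemma dvdp_prod_sqr_XsubC (R : fieldType) (h : {poly R}) (us : seq R) :
  uniq us -> (forall x, x \in us -> ('X - x%:P) ^+ 2 %| h) ->
  \prod_(x <- us) ('X - x%:P) ^+ 2 %| h.
Proof.
elim: us => [|x us IH] /=; first by rewrite big_nil dvd1p.
case/andP=> xus uus H; rewrite big_cons Gauss_dvdp.
  rewrite H ?mem_head //= IH // => y yus; apply: H; rewrite inE yus orbT //.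
rewrite coprimep_pexpl // coprimep_sym coprimep_XsubC rootE horner_prod.
rewrite prodf_seq_neq0; apply/allP => y yus /=; rewrite !hornerE expf_neq0 // subr_eq0.
by apply: contraNneq xus => ->.
Qed.

Section Gradient.
Variables (R : realType) (m : nat -> R) (n : nat) (w u : 'rV[R]_n) (s : R).
Let N := (n.*2).+1.
(** The length [N.+1] covers degree [N = 2n + 1], that of the closure moment. *)
Let T := momop m N.+1 s.
Let T' : {poly R} := \poly_(k < N.+1) (m k * (s ^+ k.-1 *+ k) / k`!%:R).
Let H : {poly R} := \prod_(x <- [seq u 0 i | i <- enum 'I_n]) ('X - x%:P) ^+ 2.

(* Gradient, with respect to the weights, the nodes and the width, of the functional
   [q |-> \sum_i w_i (dop T q).[u_i]], whose value at ['X^j] is the moment [M_j];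
   [dop T'] is the derivative of [dop T] in [s]. *)
Definition mom_grad (q : {poly R}) : 'cV[R]_(n + n + 1) :=
  col_mx (col_mx (\col_i (dop T q).[u 0 i]) (\col_i (w 0 i * (dop T q)^`().[u 0 i])))
         (\col_(_ < 1) \sum_i w 0 i * (dop T' q).[u 0 i]).

Lemma mom_gradD p q : mom_grad (p + q) = mom_grad p + mom_grad q.
Proof.
rewrite /mom_grad !add_col_mx !dopDr derivD; congr (col_mx (col_mx _ _) _).
- by apply/colP => i; rewrite !mxE hornerD.
- by apply/colP => i; rewrite !mxE hornerD mulrDr.
- apply/colP => i; rewrite !mxE -[RHS]big_split /=; apply: eq_bigr => j _.
  by rewrite hornerD mulrDr.
Qed.

Lemma mom_gradZ c q : mom_grad (c *: q) = c *: mom_grad q.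
Proof.
rewrite /mom_grad !scale_col_mx !dopZr derivZ; congr (col_mx (col_mx _ _) _).
- by apply/colP => i; rewrite !mxE hornerZ.
- by apply/colP => i; rewrite !mxE hornerZ mulrCA.
- apply/colP => i; rewrite !mxE mulr_sumr /=; apply: eq_bigr => j _.
  by rewrite hornerZ mulrCA.
Qed.

(** [T] depends on [s] and [X] only through [s X], apart from the coefficients [m k / k!], so
    [s d/ds] and [X d/dX] agree on it. *)
Lemma momop_deriv : s *: T' = 'X * T^`().
Proof.
apply/polyP => k; rewrite coefZ coefXM coef_deriv !coef_poly.
case: k => [|k] /=; first by rewrite mulr0n mulr0 mul0r mulr0.
case: ltnP => _; last by rewrite mulr0 mul0rn.
rewrite exprS !(mulrnAr, mulrnAl); congr (_ *+ _).
by rewrite !mulrA [s * m _]mulrC.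
Qed.

Variable rs : seq R.
Hypotheses (m0 : m 0 = 1) (Om : inOmega n w u s).
Hypotheses (size_rs : size rs = N) (rsE : ppoly m n = \prod_(r <- rs) ('X - r%:P)).
(** The roots are scaled by [s] because [T] is the moment series taken at [s X]. *)
Let Q : {poly R} := \prod_(r <- map (fun r => r * s) rs) (1 - r *: 'X).

Lemma momop_mulQ : exists rem, T * Q = 1 + rem * 'X^(N.+1).
Proof.
rewrite /Q big_map (prod_1subX_bcoef _ size_rs rsE).
exact: momop_mul_bcoef.
Qed.

Lemma uniq_nodes : uniq [seq u 0 i | i <- enum 'I_n].
Proof.
rewrite map_inj_uniq ?enum_uniq // => i j e; apply/val_inj => /=.
have [_ [lt_u _]] := Om.
by case: (ltngtP i j) => // /lt_u; rewrite e ltxx.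
Qed.

(** The weight components make [dop T q] vanish at the nodes and, as the weights are positive, the
    node components make its derivative vanish there. *)
Lemma sqr_nodes_dvdp q : (forall i : 'I_(n + n), mom_grad q (lshift 1 i) 0 = 0) -> H %| dop T q.
Proof.
move=> g0; apply: dvdp_prod_sqr_XsubC uniq_nodes _ => _ /mapP[i _ ->].
apply: dvdp_sqr_XsubC.
  by have := g0 (lshift n i); rewrite /mom_grad !col_mxEu mxE.
have := g0 (rshift n i); rewrite /mom_grad col_mxEu col_mxEd mxE => /eqP.
by have [w0 _] := Om; rewrite mulf_eq0 gt_eqF //= => /eqP.
Qed.

Lemma size_sqr_nodes : size H = N.
Proof.
rewrite /H prodrXl expr2 size_mul ?monic_neq0 ?monic_prod_XsubC // size_prod_XsubC.
by rewrite size_map size_enum_ord addnS /= addSn addnn.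
Qed.

Lemma sqr_nodes_ge0 x : 0 <= H.[x].
Proof. by rewrite /H prodrXl hornerE exprn_even_ge0. Qed.

Lemma sqr_nodes_monic : H \is monic.
Proof. by rewrite /H prodrXl monic_exp // monic_prod_XsubC. Qed.

Lemma sqr_nodes_root i : H.[u 0 i] = 0.
Proof.
apply/eqP; rewrite /H prodrXl hornerE expf_eq0 /= -rootE root_prod_XsubC.
by apply: map_f; rewrite mem_enum.
Qed.

Hypotheses (n0 : (0 < n)%N) (rs0 : has (fun r => r != 0) rs).

(** The weight and node components leave only multiples of [H] for [dop T q]; the width component
    excludes the nonzero ones. *)
Lemma mom_grad_inj (q : {poly R}) : (size q <= N)%N -> mom_grad q = 0 -> q = 0.
Proof.
move=> le_q g0.
have [rem e] := momop_mulQ.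
have dv : H %| dop T q by apply: sqr_nodes_dvdp => i; rewrite g0 mxE.
have Hnz : H != 0 by rewrite monic_neq0 // sqr_nodes_monic.
(* [dop T q] has size at most [N], the size of [H], so the quotient is constant. *)
have [k hE] : exists k, dop T q = k *: H.
  have [k kE] := dvdpP _ _ dv.
  have : (size k <= 1)%N.
    have [->|knz] := eqVneq k 0; first by rewrite size_poly0.
    have := leq_trans (size_dop T q) le_q; rewrite kE size_mul // size_sqr_nodes.
    by rewrite /N addnS /= -add1n leq_add2r.
  by move/size1_polyC => kc; exists k`_0; rewrite kE {1}kc mul_polyC.
have [w0 [_ s0]] := Om.
have qE : q = k *: dop Q H.
  rewrite -dopZr -hE (dopK (rem := rem) (m := N.+1)) //; first by rewrite mulrC.
  exact: leqW.
suff k0 : k = 0 by rewrite qE k0 scale0r.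
have : \sum_i w 0 i * (dop T' q).[u 0 i] = 0.
  by have := congr1 (fun A : 'cV_(n + n + 1) => A (rshift (n + n) 0) 0) g0; rewrite /mom_grad col_mxEd !mxE.
move/(congr1 (fun y => s * y)); rewrite mulr0 mulr_sumr.
(* By [momop_deriv] and [dop_logderiv], [s] times the width component is [k] times a weighted sum of
   the [y i], which are positive. *)
pose y i := (dop (- (T * 'X * Q^`())) H).[u 0 i].
have -> : \sum_i s * (w 0 i * (dop T' q).[u 0 i]) = k * \sum_i w 0 i * y i.
  rewrite mulr_sumr; apply: eq_bigr => i _.
  rewrite mulrCA -hornerZ -dopZl momop_deriv (dop_logderiv e (leqW le_q)) hE.
  by rewrite dopZr hornerZ mulrCA.
have y0 i : 0 < y i.
  have [||||Y1 Y2] := @dop_log_deriv_ge0 R (map (fun r => r * s) rs) T H N.+1 (u 0 i) _ _ Hnz.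
  - by exists rem.
  - by rewrite size_sqr_nodes.
  - exact: sqr_nodes_ge0.
  - exact: sqr_nodes_root.
  rewrite lt_def Y1 andbT eq_sym Y2 negbK has_map.
  apply: sub_has rs0 => r /= rnz.
  by rewrite mulf_neq0 // gt_eqF.
move/eqP; rewrite mulf_eq0 => /orP[/eqP //|].
rewrite gt_eqF //; rewrite (bigD1 (Ordinal n0)) //=.
apply: ltr_wpDr; last by rewrite mulr_gt0.
by apply: sumr_ge0 => i _; rewrite mulr_ge0 // ltW.
Qed.

Hypothesis (rs2 : (2 <= count (fun r : R => r != 0%R) rs)%N).

(* [dop T q = ('X - v) * H] has roots of multiplicity at most 3, and each nonzero
   root in [rs] lowers this bound by one, down to 1. *)
Lemma mom_grad_simple_roots (q : {poly R}) : q \is monic -> size q = N.+1 -> mom_grad q = 0 ->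
  exists t, [/\ uniq t, size t = N & q = \prod_(x <- t) ('X - x%:P)].
Proof.
move=> qm sq g0; have [rem e] := momop_mulQ.
have /dvdpP[k kE] : H %| dop T q by apply: sqr_nodes_dvdp => i; rewrite g0 mxE.
(* The constant coefficient of [T] is [m 0 = 1] and its other terms lower the degree. *)
have [size_g g_monic] : size (dop T q) = N.+1 /\ dop T q \is monic.
  have E : dop T q = q + \sum_(k < N) (T`_k.+1 *: q^`(k.+1)).
    rewrite (@dopE _ N.+1) ?size_poly // big_ord_recl coef_poly /= m0 expr0 fact0 invr1 !mulr1.
    by rewrite scale1r.
  have lt : (size (\sum_(k < N) (T`_k.+1 *: q^`(k.+1)))%R < size q)%N.
    apply: leq_ltn_trans (size_sum _ _ _) _; rewrite sq ltnS; apply/bigmax_leqP => j _.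
    apply: leq_trans (size_scale_leq _ _) _; elim: (val j) => [|i IH].
      by rewrite derivn1 -ltnS -sq lt_size_deriv // monic_neq0.
    rewrite derivnS (leq_trans _ IH) // leq_eqVlt; apply/orP.
    by have [->|nz] := eqVneq q^`(i.+1) 0; [left; rewrite deriv0|
      right; rewrite lt_size_deriv].
  by rewrite E size_polyDl // monicE lead_coefDl // sq (monicP qm).
have Hm := sqr_nodes_monic.
have km : k \is monic by rewrite -(monicMr _ Hm) -kE.
have sk : size k = 2.
  move: size_g; rewrite kE size_Mmonic // ?monic_neq0 // size_sqr_nodes /N addnS /= -[n.*2.+2]add2n.
  exact: addIn.
have [v vE] : exists v, k = 'X - v%:P.
  exists (- k`_0); apply/polyP => i; rewrite !coefE.
  case: i => [|[|i]] /=; rewrite ?opprK ?add0r ?subr0 //.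
    by move: km; rewrite monicE lead_coefE sk => /eqP.
  by rewrite nth_default ?sk ?subr0 ?oppr0 ?addr0.
pose us := [seq u 0 i | i <- enum 'I_n].
have gE : dop T q = \prod_(x <- v :: us ++ us) ('X - x%:P).
  by rewrite kE vE /H prodrXl big_cons big_cat expr2.
have g_splits : splits (dop T q) by exists (v :: us ++ us).
(* A node has multiplicity 2, or 3 if it equals [v]. *)
have g_mult x : ~~ (('X - x%:P) ^+ 4 %| dop T q).
  rewrite -mup_ltn ?monic_neq0 // gE mu_prod_XsubC /= count_cat.
  rewrite (count_uniq_mem x uniq_nodes).
  by case: (x \in us) (v == x) => [] [].
have [f_splits f_mult] := dop_prod_simple_roots (map (fun r => r * s) rs) g_splits g_mult.
have qE : dop Q (dop T q) = q.
  by apply: dopK; [rewrite mulrC; exact: e|rewrite sq].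
rewrite -/Q qE in f_splits f_mult.
have [x|t tu tE] := splits_uniq f_splits.
  have := f_mult x; suff -> : (2 - count (fun r : R => r != 0%R) (map (fun r => (r * s)%R) rs))%N = 0%N by [].
  apply/eqP; rewrite subn_eq0 count_map; apply: leq_trans rs2 _.
  by have [_ [_ s0]] := Om; apply: sub_count => r /= rnz; rewrite mulf_neq0 // gt_eqF.
exists t; split => //; by have := sq; rewrite tE size_prod_XsubC => -[].
Qed.

End Gradient.

Local Open Scope classical_set_scope.
Local Open Scope ring_scope.

(** * Strict differentiability and local sections *)

Lemma row_norm_le (R : realType) (p : nat) (v : 'rV[R]_p) (e : R) :
  0 <= e -> (forall i, `|v 0 i| <= e) -> `|v| <= e.
Proof.
move=> e0 H; rewrite /Num.norm /= mx_normrE; apply/bigmax_leP; split => // -[i j] _ /=.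
by rewrite (ord1 i).
Qed.

Lemma mx_coord_le (R : realType) (p q : nat) (A : 'M[R]_(p, q)) i j : `|A i j| <= `|A|.
Proof.
rewrite [leRHS]/Num.norm /= mx_normrE.
exact: (le_bigmax _ (fun k : 'I_p * 'I_q => `|A k.1 k.2|) (i, j)).
Qed.

Lemma mulmx_bounded (R : realType) (p q : nat) (B : 'M[R]_(p, q)) :
  exists2 C, 0 < C & forall v : 'rV_p, `|v *m B| <= C * `|v|.
Proof.
exists (1 + \sum_i \sum_j `|B i j|).
  by rewrite ltr_wpDr // sumr_ge0 // => i _; apply: sumr_ge0.
move=> v; apply: row_norm_le => [|j].
  by rewrite mulr_ge0 // addr_ge0 // sumr_ge0 // => i _; apply: sumr_ge0.
rewrite mxE; apply: le_trans (ler_norm_sum _ _ _) _.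
rewrite mulrDl mul1r -[leLHS]add0r lerD // mulr_suml; apply: ler_sum => i _.
rewrite normrM mulrC; apply: ler_pM => //; last exact: mx_coord_le.
by rewrite (bigD1 j) //= lerDl sumr_ge0.
Qed.

(* The library provides both structures on matrices, but not their join. *)
HB.instance Definition _ (R : realType) (m n : nat) := Complete.on 'M[R]_(m, n).

(** Both points vary, unlike in ordinary differentiability: for linear [L], the remainder [f - L] is
    Lipschitz near [x] with an arbitrarily small constant. *)
Definition strict_diff (R : realType) (U V : normedModType R) (f : U -> V) (L : U -> V) (x : U) :=
  forall e : R, 0 < e -> exists2 d : R, 0 < d & forall y z, `|y - x| < d -> `|z - x| < d ->
    `|f y - f z - L (y - z)| <= e * `|y - z|.

(* Banach's fixed point theorem applied to [y |-> z - (f (x + y *m B) - f x - y)]. *)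
Lemma strict_diff_section (R : realType) (p q : nat) (f : 'rV[R]_p -> 'rV[R]_q)
    (J : 'M[R]_(p, q)) (B : 'M[R]_(q, p)) (x : 'rV[R]_p) :
  strict_diff f (mulmxr J) x -> B *m J = 1%:M ->
  forall e : R, 0 < e -> exists2 d, 0 < d & forall z : 'rV[R]_q, `|z| < d ->
    exists2 y : 'rV[R]_q, f (x + y *m B) = f x + z & `|y - z| <= e * `|z|.
Proof.
move=> sf BJ.
(* The bound [e <= 1] makes the fixed-point map a contraction that preserves the ball of radius
   [2 * |z|]. *)
suff main e : 0 < e -> e <= 1 -> exists2 d, 0 < d & forall z : 'rV[R]_q, `|z| < d ->
    exists2 y : 'rV[R]_q, f (x + y *m B) = f x + z & `|y - z| <= e * `|z|.
  move=> e e0; have [||d d0 H] := main (Num.min e 1).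
  - by rewrite lt_min e0 ltr01.
  - by rewrite ge_min lexx orbT.
  exists d => // z /H[y y1 y2]; exists y => //; apply: le_trans y2 _.
  by rewrite ler_wpM2r // ge_min lexx.
move=> e0 e1; have [C C0 HC] := mulmx_bounded B.
(* This tolerance makes the remainder [r] below Lipschitz with constant [e / 2]; the radius
   [d / (2 * C)] for [z] keeps [x + y *m B] within [d] of [x] when [|y| <= 2 * |z|]. *)
have [|d d0 Hd] := sf (e / (2 * C)); first by rewrite divr_gt0 // mulr_gt0.
exists (d / (2 * C)); first by rewrite divr_gt0 // mulr_gt0.
move=> z zd; pose U := [set y : 'rV[R]_q | `|y| <= 2 * `|z|].
pose r y := f (x + y *m B) - f x - y.
have rlip y y' : U y -> U y' -> `|r y - r y'| <= e / 2 * `|y - y'|.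
  move=> Uy Uy'.
  have Hx v : U v -> `|x + v *m B - x| < d.
    move=> Uv; rewrite addrAC subrr add0r; apply: le_lt_trans (HC v) _.
    apply: le_lt_trans (ler_wpM2l (ltW C0) Uv) _.
    by move: zd; rewrite ltr_pdivlMr ?mulr_gt0 // mulrC mulrCA !mulrA.
  have := Hd _ _ (Hx _ Uy) (Hx _ Uy').
  rewrite opprD addrACA subrr add0r /= -mulmxBl -mulmxA BJ mulmx1.
  have -> : r y - r y' = f (x + y *m B) - f (x + y' *m B) - (y - y').
    by apply/rowP => k; rewrite /r !mxE; ring.
  move/le_trans; apply.
  apply: le_trans (ler_wpM2l _ (HC _)) _; first by rewrite ltW // divr_gt0 // mulr_gt0.
  rewrite mulrA le_eqVlt; apply/orP; left; apply/eqP; congr (_ * _); field.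
  by rewrite gt_eqF.
have U0 : U 0 by rewrite /U /= normr0 mulr_ge0.
have r0 : r 0 = 0 by rewrite /r mul0mx addr0 subrr subr0.
have Phi_fun : {homo (fun y => z - r y) : y / U y >-> U y}.
  move=> y Uy; rewrite /U /=; apply: le_trans (ler_normB _ _) _.
  have := rlip _ _ Uy U0; rewrite r0 !subr0 => H.
  rewrite mulr2n mulrDl mul1r lerD2l; apply: le_trans H _.
  apply: le_trans (ler_wpM2l _ Uy) _; first by rewrite ltW // divr_gt0.
  by rewrite mulrA divfK ?gt_eqF // ler_piMl.
have clU : closed U.
  apply: (@closed_comp _ _ (fun y : 'rV[R]_q => `|y|) [set t | t <= 2 * `|z|]).
    by move=> y _; exact: norm_continuous.
  exact: closed_le.
have e2 : 0 <= e / 2 by rewrite ltW // divr_gt0.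
have ctr : is_contraction (mkfun_fun Phi_fun).
  exists (NngNum e2); split => /=.
    by rewrite ltr_pdivrMr // mul1r (le_lt_trans e1) // ltr1n.
  move=> [y y'] [/= Uy Uy'].
  suff : `|(z - r y) - (z - r y')| <= e / 2 * `|y - y'| by [].
  have E (a b c : 'rV[R]_q) : a - b - (a - c) = c - b by rewrite opprB addrC addrA subrK.
  by rewrite E distrC; exact: rlip.
have [|y Uy yE] := banach_fixed_point ctr clU; first by exists 0.
have {}yE : y = z - r y by [].
exists y.
  apply/rowP => k; have := congr1 (fun v : 'rV_q => v 0 k) yE; rewrite /r !mxE; lra.
have -> : y - z = - r y by rewrite [in LHS]yE addrAC subrr add0r.
rewrite normrN; have := rlip _ _ Uy U0; rewrite r0 !subr0 => H.
apply: le_trans H _; apply: le_trans (ler_wpM2l e2 Uy) _.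
by rewrite mulrA divfK // gt_eqF.
Qed.

(** The section realizes [f x + h v] exactly as [f (x + y *m B)] with [y] close to [h v]; there [F]
    can be replaced by [g], whose expansion yields [h (v B G)]. *)
Lemma strict_diff_chain_rule (R : realType) (p q : nat) (f : 'rV[R]_p -> 'rV[R]_q)
    (g : 'rV[R]_p -> R) (F : 'rV[R]_q -> R) (J : 'M[R]_(p, q)) (G : 'cV[R]_p)
    (B : 'M[R]_(q, p)) (x : 'rV[R]_p) (v : 'rV[R]_q) (a : R) :
  strict_diff f (mulmxr J) x -> strict_diff g (fun y => (y *m G) 0 0) x ->
  B *m J = 1%:M -> (\forall y \near x, F (f y) = g y) ->
  is_derive (f x) v F a -> a = (v *m B *m G) 0 0.
Proof.
move=> sf sg BJ Fg [_ <-]; apply: cvg_lim => //.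
have [C C0 HC] := mulmx_bounded B; have [D D0 HD] := mulmx_bounded (B *m G).
apply/cvgrPdist_le => e e0.
(* [nv] is positive even if [v = 0]. As [|y *m B| <= 2 C |h| nv], the error of [g] is at most
   [|h| e / 2]; [e'] bounds the error of the section likewise, and [e' <= 1] gives
   [|y| <= 2 |h v|]. *)
pose nv := 1 + `|v|; have nv0 : 0 < nv by rewrite ltr_wpDr.
have [|d1 d10 Hg] := sg (e / (4 * C * nv)); first by rewrite divr_gt0 // !mulr_gt0.
pose e' := Num.min 1 (e / (2 * D * nv)).
have e'0 : 0 < e' by rewrite lt_min ltr01 divr_gt0 // !mulr_gt0.
have [d2 d20 Hs] := strict_diff_section sf BJ e'0.
have /nbhs_ballP[d3 /= d30 Hd3] := Fg.
pose dm := Num.min d2 (Num.min d1 d3 / (2 * C)).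
have dm0 : 0 < dm by rewrite lt_min d20 divr_gt0 ?mulr_gt0 // lt_min d10.
apply/nbhs_ballP; exists (dm / nv) => [|h /=]; first by rewrite /= divr_gt0.
rewrite -ball_normE /= sub0r normrN ltr_pdivlMr // => hd h0.
have nh0 : 0 < `|h| by rewrite normr_gt0.
have hv : `|h *: v| <= `|h| * nv by rewrite normrZ ler_wpM2l // lerDr.
have hvd : `|h *: v| < dm by exact: le_lt_trans hv hd.
have [|y yE yB] := Hs (h *: v); first by rewrite (lt_le_trans hvd) // ge_min lexx.
have ny : `|y| <= 2 * `|h *: v|.
  rewrite -[y](subrK (h *: v)); apply: le_trans (ler_normD _ _) _.
  rewrite mulr2n mulrDl mul1r lerD2r; apply: le_trans yB _.
  by rewrite ler_piMl // ge_min lexx.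
have nyB : `|y *m B| <= C * (2 * `|h *: v|) by apply: le_trans (HC y) _; rewrite ler_wpM2l // ltW.
have nyB' : `|y *m B| < Num.min d1 d3.
  apply: le_lt_trans nyB _; rewrite mulrA [C * 2]mulrC -ltr_pdivlMl ?mulr_gt0 // [ltRHS]mulrC.
  by apply: lt_le_trans hvd _; rewrite ge_min lexx orbT.
have -> : (F \o shift (f x)) (h *: v) - F (f x) = g (x + y *m B) - g x.
  rewrite /= [h *: v + _]addrC -yE !Hd3 //; first exact: ballxx.
  rewrite -ball_normE /= opprD addrA subrr sub0r normrN.
  by rewrite (lt_le_trans nyB') // ge_min lexx orbT.
have Hgy := Hg (x + y *m B) x; rewrite addrAC subrr add0r in Hgy.
have {Hgy}Hgy : `|g (x + y *m B) - g x - (y *m B *m G) 0 0| <= e / (4 * C * nv) * `|y *m B|.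
  by apply: Hgy; rewrite ?subrr ?normr0 // (lt_le_trans nyB') // ge_min lexx.
have HyG : `|(y *m B *m G) 0 0 - h * (v *m B *m G) 0 0| <= D * `|y - h *: v|.
  have -> : (y *m B *m G) 0 0 - h * (v *m B *m G) 0 0 = ((y - h *: v) *m (B *m G)) 0 0.
    have E (A D' : 'M[R]_1) c : (A - c *: D') 0 0 = A 0 0 - c * D' 0 0 by rewrite !mxE.
    by rewrite mulmxBl -scalemxAl !mulmxA E.
  exact: le_trans (mx_coord_le _ _ _) (HD _).
rewrite -[X in X - _](mulKf h0) /GRing.scale /= -mulrBr normrM normfV ler_pdivrMl //.
rewrite distrC -[_ - h * _](subrKA ((y *m B *m G) 0 0)).
apply: le_trans (ler_normD _ _) _.
have T1 : e / (4 * C * nv) * `|y *m B| <= `|h| * e / 2.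
  apply: le_trans (ler_wpM2l _ nyB) _; first by rewrite ltW // divr_gt0 // !mulr_gt0.
  apply: (@le_trans _ _ (e / (4 * C * nv) * (C * (2 * (`|h| * nv))))).
    by rewrite !ler_wpM2l // ?ltW // divr_gt0 // !mulr_gt0.
  by rewrite le_eqVlt; apply/orP; left; apply/eqP; field; rewrite !gt_eqF.
have T2 : D * `|y - h *: v| <= `|h| * e / 2.
  apply: le_trans (ler_wpM2l (ltW D0) yB) _.
  apply: (@le_trans _ _ (D * (e / (2 * D * nv) * (`|h| * nv)))).
    apply: ler_wpM2l; first exact: ltW.
    apply: ler_pM => //; first exact: ltW.
    by rewrite ge_min lexx orbT.
  by rewrite le_eqVlt; apply/orP; left; apply/eqP; field; rewrite !gt_eqF.
apply: le_trans (lerD (le_trans Hgy T1) (le_trans HyG T2)) _.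
by rewrite -splitr.
Qed.

(* Caratheodory's form of strict differentiability: it is stable under products by
   continuity alone, without estimates. *)
Definition caratheodory (R : realType) (p : nat) (f : 'rV[R]_p -> R) (x : 'rV[R]_p) (g : 'cV[R]_p) :=
  {for x, continuous f} /\
  exists D : 'rV[R]_p * 'rV[R]_p -> 'cV[R]_p,
    (forall y z, f y - f z = ((y - z) *m D (y, z)) 0 0) /\ D yz @[yz --> (x, x)] --> g.

Section Caratheodory.
Variables (R : realType) (p : nat) (x : 'rV[R]_p).
Implicit Types (f h : 'rV[R]_p -> R) (g k : 'cV[R]_p).

Lemma caratheodory_cst c : caratheodory (fun=> c) x 0.
Proof.
split; first exact: cst_continuous.
exists (fun=> 0); split; last exact: cvg_cst.
by move=> y z; rewrite mulmx0 mxE subrr.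
Qed.

Lemma caratheodory_coord i : caratheodory (fun y => y 0 i) x (delta_mx i 0).
Proof.
split; first exact: coord_continuous.
exists (fun=> delta_mx i 0); split; last exact: cvg_cst.
by move=> y z; rewrite -colE !mxE.
Qed.

Lemma caratheodoryD f h g k :
  caratheodory f x g -> caratheodory h x k -> caratheodory (fun y => f y + h y) x (g + k).
Proof.
move=> [cf [Df [fE fl]]] [ch [Dh [hE hl]]]; split; first exact: (@continuousD _ _ _ f h).
exists (fun yz => Df yz + Dh yz); split; last exact: cvgD.
by move=> y z; rewrite opprD addrACA fE hE mulmxDr [in RHS]mxE.
Qed.

Lemma caratheodoryM f h g k : caratheodory f x g -> caratheodory h x k ->
  caratheodory (fun y => f y * h y) x (h x *: g + f x *: k).
Proof.
move=> [cf [Df [fE fl]]] [ch [Dh [hE hl]]]; split; first exact: (@continuousM _ _ f h).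
exists (fun yz => h yz.2 *: Df yz + f yz.1 *: Dh yz); split.
  move=> y z /=; rewrite mulmxDr -!scalemxAr.
  have E (A B : 'M[R]_1) (a b : R) : (a *: A + b *: B) 0 0 = a * A 0 0 + b * B 0 0 by rewrite !mxE.
  by rewrite E -fE -hE; ring.
apply: cvgD; apply: cvgZ => //.
- exact: (cvg_comp _ _ (@cvg_snd _ _ (nbhs x) (nbhs x) _) ch).
- exact: (cvg_comp _ _ (@cvg_fst _ _ (nbhs x) (nbhs x) _) cf).
Qed.

Lemma caratheodoryX f g n :
  caratheodory f x g -> caratheodory (fun y => f y ^+ n) x ((f x ^+ n.-1 *+ n) *: g).
Proof.
move=> fg; elim: n => [|n IH].
  by rewrite mulr0n scale0r; exact: caratheodory_cst.
have := caratheodoryM fg IH; congr (caratheodory _ _ _).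
  by apply/funext => y; rewrite exprS.
rewrite scalerA -scalerDl; congr (_ *: _).
by case: n {IH} => [|n]; rewrite ?mulr0n ?mulr0 ?addr0 // mulrnAr -exprS [RHS]mulrS.
Qed.

Lemma caratheodory_sum n (f : 'I_n -> 'rV[R]_p -> R) (g : 'I_n -> 'cV[R]_p) :
  (forall i, caratheodory (f i) x (g i)) ->
  caratheodory (fun y => \sum_i f i y) x (\sum_i g i).
Proof.
elim: n f g => [|n IH] f g H.
  have -> : (fun y => \sum_(i < 0) f i y) = (fun=> 0) by apply/funext => y; rewrite big_ord0.
  by rewrite big_ord0; exact: caratheodory_cst.
have -> : (fun y => \sum_(i < n.+1) f i y) = fun y => f ord0 y + \sum_(i < n) f (lift ord0 i) y.
  by apply/funext => y; rewrite big_ord_recl.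
by rewrite big_ord_recl; apply: caratheodoryD => //; exact: IH.
Qed.

Lemma caratheodory_near f g (e : R) : caratheodory f x g -> 0 < e ->
  \forall yz \near (x, x), `|f yz.1 - f yz.2 - ((yz.1 - yz.2) *m g) 0 0| <= e * `|yz.1 - yz.2|.
Proof.
move=> [_ [D [fE fl]]] e0.
have ep0 : 0 < e / p.+1%:R by rewrite divr_gt0.
have := (cvgrPdist_le _ _).1 fl _ ep0.
move/(_ (nbhs_filter (x, x))); apply: (@filterS _ _ (nbhs_filter (x, x))) => -[y z] /= H.
rewrite fE; have -> : ((y - z) *m D (y, z)) 0 0 - ((y - z) *m g) 0 0 = ((y - z) *m (D (y, z) - g)) 0 0.
  by rewrite mulmxBr [RHS]mxE [X in _ = _ + X]mxE.
rewrite mxE; apply: le_trans (ler_norm_sum _ _ _) _.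
apply: (@le_trans _ _ (\sum_(i < p) `|y - z| * (e / p.+1%:R))).
  apply: ler_sum => i _; rewrite normrM; apply: ler_pM => //; first exact: mx_coord_le.
  by apply: le_trans H; rewrite distrC; exact: mx_coord_le.
rewrite sumr_const card_ord -mulrnAr mulrC ler_wpM2r // -mulr_natr -mulrA.
by rewrite ger_pMr // mulrC ler_pdivrMr // mul1r ler_nat.
Qed.

Lemma strict_diff_near (V : normedModType R) (f L : 'rV[R]_p -> V) :
  (forall e, 0 < e -> \forall yz \near (x, x),
     `|f yz.1 - f yz.2 - L (yz.1 - yz.2)| <= e * `|yz.1 - yz.2|) ->
  strict_diff f L x.
Proof.
move=> H e e0; have /nbhs_ballP[d /= d0 Hd] := H e e0.
exists d => // y z yd zd; apply: (Hd (y, z)).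
by split; rewrite /= -ball_normE /= distrC.
Qed.

Lemma caratheodory_strict_diff f g :
  caratheodory f x g -> strict_diff f (fun y => (y *m g) 0 0) x.
Proof. by move=> fg; apply: strict_diff_near => e; exact: caratheodory_near. Qed.

Lemma caratheodory_strict_diff_row q (f : 'rV[R]_p -> 'rV[R]_q) (J : 'M[R]_(p, q)) :
  (forall j, caratheodory (fun y => f y 0 j) x (col j J)) -> strict_diff f (mulmxr J) x.
Proof.
move=> fJ; apply: strict_diff_near => e e0.
have : \forall yz \near (x, x), forall j,
    `|f yz.1 0 j - f yz.2 0 j - ((yz.1 - yz.2) *m col j J) 0 0| <= e * `|yz.1 - yz.2|.
  apply: (@filter_forall _ _ _ _ (nbhs_filter (x, x))) => j; exact: (caratheodory_near (fJ j) e0).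
apply: (@filterS _ _ (nbhs_filter (x, x))) => -[y z] /= H.
apply: row_norm_le => [|j]; first by rewrite mulr_ge0 // ltW.
apply: le_trans (H j); rewrite le_eqVlt; apply/orP; left; apply/eqP; congr `|_|.
by rewrite colE mulmxA -colE !mxE.
Qed.

End Caratheodory.

(** * The moments as functions of weights, nodes and width *)

Section Moments.
Variables (R : realType) (m : nat -> R) (n : nat).
Let p := (n + n + 1)%N.
(** The parameters form one row vector, with its blocks in the order of those of [mom_grad]. *)
Definition weights (x : 'rV[R]_p) : 'rV[R]_n := lsubmx (lsubmx x).
Definition nodes (x : 'rV[R]_p) : 'rV[R]_n := rsubmx (lsubmx x).
Definition width (x : 'rV[R]_p) : R := rsubmx x 0 0.
Definition mom (j : nat) (x : 'rV[R]_p) : R :=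
  \sum_(i < n) weights x 0 i * Delta m j (nodes x 0 i) (width x).

(** The product rule yields the partial derivatives of [Delta], which [dop_poly_Xn] identifies with
    the operator values in [mom_grad]. *)
Lemma mom_caratheodory (j : nat) (x : 'rV[R]_p) : (j <= (n.*2).+1)%N ->
  caratheodory (mom j) x (mom_grad m (weights x) (nodes x) (width x) 'X^j).
Proof.
move=> le_j.
pose ew i : 'I_p := lshift 1 (lshift n i).
pose eu i : 'I_p := lshift 1 (rshift n i).
pose es : 'I_p := rshift (n + n) 0.
have cw i : caratheodory (fun y => weights y 0 i) x (delta_mx (ew i) 0).
  have := caratheodory_coord x (ew i); congr (caratheodory _ _ _).
  by apply/funext => y; rewrite !mxE.
have cu i : caratheodory (fun y => nodes y 0 i) x (delta_mx (eu i) 0).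
  have := caratheodory_coord x (eu i); congr (caratheodory _ _ _).
  by apply/funext => y; rewrite !mxE.
have cs : caratheodory width x (delta_mx es 0).
  have := caratheodory_coord x es; congr (caratheodory _ _ _).
  by apply/funext => y; rewrite /width mxE.
set s := width x; set u := nodes x; set w := weights x.
pose dU i := \sum_(k < j.+1) 'C(j, k)%:R * m k * s ^+ k * (u 0 i ^+ (j - k).-1 *+ (j - k)).
pose dS i := \sum_(k < j.+1) 'C(j, k)%:R * m k * (s ^+ k.-1 *+ k) * u 0 i ^+ (j - k).
have cD i : caratheodory (fun y => Delta m j (nodes y 0 i) (width y)) x
    (dU i *: delta_mx (eu i) 0 + dS i *: delta_mx es 0).
  have := caratheodory_sum (fun k : 'I_j.+1 =>
    caratheodoryM (caratheodoryM (caratheodory_cst x ('C(j, k)%:R * m k)) (caratheodoryX k cs))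
      (caratheodoryX (j - k) (cu i))).
  congr (caratheodory _ _ _).
  rewrite /dU /dS !scaler_suml -big_split /=; apply: eq_bigr => k _.
  rewrite scaler0 add0r !scalerA addrC; congr (_ *: _ + _ *: _).
  by rewrite -mulrA mulrC.
have := caratheodory_sum (fun i => caratheodoryM (cw i) (cD i)).
congr (caratheodory _ _ _).
have lt_j : (j < (n.*2).+2)%N by [].
have TE i : (dop (momop m (n.*2).+2 s) 'X^j).[u 0 i] = Delta m j (u 0 i) s.
  rewrite /momop (dop_poly_Xn (fun k => m k * s ^+ k)) // horner_sum.
  by apply: eq_bigr => k _; rewrite hornerZ hornerXn mulrA.
have dTE i : (dop (momop m (n.*2).+2 s) 'X^j)^`().[u 0 i] = dU i.
  rewrite /momop (dop_poly_Xn (fun k => m k * s ^+ k)) // raddf_sum horner_sum.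
  by apply: eq_bigr => k _; rewrite /= derivZ derivXn hornerZ hornerMn hornerXn mulrA.
have TE' i : (dop (\poly_(k < (n.*2).+2) (m k * (s ^+ k.-1 *+ k) / k`!%:R)) 'X^j).[u 0 i] = dS i.
  rewrite (dop_poly_Xn (fun k => m k * (s ^+ k.-1 *+ k))) // horner_sum.
  by apply: eq_bigr => k _; rewrite hornerZ hornerXn mulrA.
rewrite -/s -/u -/w.
apply/colP => k; rewrite summxE.
have E i : (Delta m j (u 0 i) s *: (delta_mx (ew i) 0 : 'cV[R]_p)
    + w 0 i *: (dU i *: delta_mx (eu i) 0 + dS i *: delta_mx es 0)) k 0
    = Delta m j (u 0 i) s * (k == ew i)%:R
      + w 0 i * (dU i * (k == eu i)%:R + dS i * (k == es)%:R) :> R.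
  by rewrite !mxE !andbT.
rewrite (eq_bigr _ (fun i _ => E i)) {E}.
have pick (F : 'I_n -> R) l : \sum_i F i * (l == i)%:R = F l.
  by rewrite (bigD1 l) //= eqxx mulr1 big1 ?addr0 // => i il; rewrite eq_sym (negPf il) mulr0.
case: (split_ordP k) => {}k ->; last first.
  rewrite /mom_grad col_mxEd mxE; apply: eq_bigr => i _.
  by rewrite TE' !eq_shift (ord1 k) eqxx !mulr0 !add0r mulr1.
rewrite /mom_grad col_mxEu; case: (split_ordP k) => {}k ->.
  rewrite col_mxEu mxE TE -[RHS](pick (fun i => Delta m j (u 0 i) s)); apply: eq_bigr => i _.
  by rewrite !eq_shift !mulr0 addr0 mulr0 addr0.
rewrite col_mxEd mxE dTE -[RHS](pick (fun i => w 0 i * dU i)); apply: eq_bigr => i _.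
by rewrite !eq_shift !mulr0 addr0 add0r mulrA.
Qed.

Lemma near_inOmega (x : 'rV[R]_p) : inOmega n (weights x) (nodes x) (width x) ->
  \forall y \near x, inOmega n (weights y) (nodes y) (width y).
Proof.
case=> w0 [lt_u s0].
have coord k : (fun y : 'rV[R]_p => y 0 k) @ x --> x 0 k by exact: coord_continuous.
have H1 : \forall y \near x, forall i, 0 < weights y 0 i.
  apply: (@filter_forall _ _ _ _ (nbhs_filter x)) => i; have := w0 i; rewrite !mxE => w0i.
  by near=> y; rewrite !mxE; near: y; exact: (cvgr_gt (x 0 (lshift 1 (lshift n i))) (coord _) _ w0i).
have H2 : \forall y \near x, forall i j : 'I_n, (i < j)%N -> nodes y 0 i < nodes y 0 j.
  apply: (@filter_forall _ _ _ _ (nbhs_filter x)) => i; apply: (@filter_forall _ _ _ _ (nbhs_filter x)) => j.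
  case: (ltnP i j) => [lt_ij|_]; last exact: nearW.
  have := lt_u _ _ lt_ij; rewrite !mxE -subr_gt0 => H.
  near=> y => _; rewrite !mxE -subr_gt0; near: y.
  exact: (cvgr_gt _ (cvgB (coord _) (coord _)) _ H).
have H3 : \forall y \near x, 0 < width y.
  move: s0; rewrite /width mxE => s0.
  by near=> y; rewrite mxE; near: y; exact: (cvgr_gt _ (coord _) _ s0).
by near=> y; split; [near: y | split; near: y].
Unshelve. all: by end_near. Qed.

(** Injectivity forces the preimage picked by choice to be the given parameters. *)
Lemma closure_momE (x : 'rV[R]_p) : Minjective m n ->
  inOmega n (weights x) (nodes x) (width x) ->
  closure_mom m n (Mvec m n (weights x) (nodes x) (width x)) = mom (n.*2).+1 x.
Proof.
move=> inj Om; rewrite /closure_mom; case: pselect => [ex|nex].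
  case: cid => -[[w u] s] /= [Om' e].
  by have [-> -> ->] := inj _ _ _ _ _ _ Om' Om e.
by case: nex; exists (weights x, nodes x, width x).
Qed.

End Moments.

(** * Companion matrix and strict hyperbolicity *)

Lemma char_poly_companion (F : comNzRingType) (k : nat) (c : {poly F}) (A : 'M[F]_k) :
  c \is monic -> size c = k.+1 ->
  (forall i j, A i j = if (i == k.-1 :> nat) then - c`_j else (i.+1 == j :> nat)%:R) ->
  char_poly A = c.
Proof.
(* The order of [companionmx c] is [(size c).-1], so [k] is replaced by this expression before the
   matrices are compared. *)
move=> cm sc; have := congr1 predn sc; rewrite /= => e; case: k / e A sc => A _ AE.
suff -> : A = companionmx c by exact: companionmxK.
by apply/matrixP => i j; rewrite AE mxE.
Qed.

Lemma mom_grad_sum (R : realType) (m : nat -> R) n w u s k (c : 'I_k -> R) (q : 'I_k -> {poly R}) :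
  @mom_grad R m n w u s (\sum_i c i *: q i) = \sum_i c i *: mom_grad m w u s (q i).
Proof.
rewrite (big_morph (mom_grad m w u s) (@mom_gradD _ m n w u s) (_ : _ = 0)).
  by apply: eq_bigr => i _; rewrite mom_gradZ.
by rewrite -(scale0r 0) mom_gradZ scale0r.
Qed.

Theorem theorem2p8 (R : realType) (K : R -> R) (n : nat) :
  is_kernel K -> (1 <= n)%N ->
  Minjective (kmoment K) n ->
  (exists rs : seq R,
      [/\ size rs = (n.*2).+1,
          ppoly (kmoment K) n = \prod_(r <- rs) ('X - r%:P)
        & (2 <= count (fun r : R => r != 0%R) rs)%N]) ->
  forall (M : 'rV[R]_((n.*2).+1)), Mimage (kmoment K) n M ->
  forall a : 'rV[R]_((n.*2).+1),
    (forall j : 'I_((n.*2).+1),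
        is_derive M (delta_mx 0 j) (closure_mom (kmoment K) n) (a 0 j)) ->
    strictly_hyperbolic ((n.*2).+1) (Amat n a).
Proof.
move=> [_ [_ [_ [m0 _]]]] n1 inj [rs [size_rs rsE rs2]] M [w [u [s [Om ME]]]] a Ha.
move: (kmoment K) m0 inj rsE ME Ha => m m0 inj rsE ME Ha.
pose N := (n.*2).+1.
pose x : 'rV[R]_(n + n + 1) := row_mx (row_mx w u) (const_mx s).
have xw : weights x = w by rewrite /weights !row_mxKl.
have xu : nodes x = u by rewrite /nodes row_mxKl row_mxKr.
have xs : width x = s by rewrite /width row_mxKr mxE.
have Omx : inOmega n (weights x) (nodes x) (width x) by rewrite xw xu xs.
pose f (y : 'rV[R]_(n + n + 1)) := Mvec m n (weights y) (nodes y) (width y).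
have fx : f x = M by rewrite /f xw xu xs.
pose grad := mom_grad m w u s.
(* Row vectors are differentiated by right multiplication, so column [j] is the gradient of the
   moment [M_j]. *)
pose J : 'M[R]_(n + n + 1, N) := \matrix_(i, j) grad 'X^j i 0.
have colJ j : col j J = grad 'X^j by apply/colP => i; rewrite !mxE.
have sf : strict_diff f (mulmxr J) x.
  apply: caratheodory_strict_diff_row => j; rewrite colJ.
  have := mom_caratheodory m x (ltnW (ltn_ord j)); rewrite xw xu xs.
  by congr (caratheodory _ _ _); apply/funext => y; rewrite mxE.
have sg : strict_diff (mom m N) (fun y => (y *m grad 'X^N) 0 0) x.
  apply: caratheodory_strict_diff.
  by have := mom_caratheodory m x (leqnn N); rewrite xw xu xs.
have rs0 : has (fun r : R => r != 0) rs by rewrite has_count (leq_trans _ rs2).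
have gradJ (c : 'cV[R]_N) : J *m c = grad (\sum_j c j 0 *: 'X^j).
  rewrite /grad mom_grad_sum; apply/colP => i; rewrite mxE summxE.
  by apply: eq_bigr => j _; rewrite !mxE mulrC.
(* The vector [c] is read as the coefficients of a polynomial of size at most [N], to which
   [mom_grad_inj] applies. *)
have Jinj (c : 'cV[R]_N) : J *m c = 0 -> c = 0.
  rewrite gradJ => /(mom_grad_inj m0 Om size_rs rsE n1 rs0) H.
  have {H} : \poly_(j < N) (\row_i c i 0) 0 (inord j) = 0.
    rewrite poly_def -[RHS]H; last first.
      rewrite (_ : \sum_j _ = \poly_(j < N) c (inord j) 0) ?size_poly // poly_def.
      by apply: eq_bigr => j _; rewrite inord_val.
    by apply: eq_bigr => j _; rewrite mxE inord_val.
  move=> /polyP H; apply/colP => j; have := H j.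
  by rewrite coef_poly ltn_ord coef0 mxE inord_val => ->; rewrite mxE.
have rkJ : \rank J = N.
  rewrite -mxrank_tr; apply/eqP/inj_row_free => v vJ.
  apply: trmx_inj; rewrite trmx0; apply: Jinj.
  by apply: trmx_inj; rewrite trmx_mul trmxK vJ trmx0.
have [B BJ] : exists B, B *m J = 1%:M by apply/row_fullP; rewrite /row_full rkJ.
(* As [n + n + 1 = N], the matrix [J] is square and its left inverse is also a right inverse. *)
have [B' JB'] : exists B', J *m B' = 1%:M.
  by apply/row_freeP; rewrite /row_free rkJ /N addn1 addnn.
have BB' : B' = B by rewrite -[B']mul1mx -BJ -mulmxA JB' mulmx1.
rewrite {}BB' in JB'.
have near_F : \forall y \near x, closure_mom m n (f y) = mom m N y.
  apply: (@filterS _ _ (nbhs_filter x)) (near_inOmega Omx) => y.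
  exact: closure_momE.
(* The chain rule along the basis vector [delta_mx 0 j] reads off row [j] of [B]. *)
have aE : a^T = B *m grad 'X^N.
  apply/colP => j; rewrite mxE.
  have := Ha j; rewrite -fx => /(strict_diff_chain_rule sf sg BJ near_F) ->.
  by rewrite -mulmxA -rowE mxE.
have gradN : grad 'X^N = J *m a^T by rewrite aE mulmxA JB' mul1mx.
(* This will be the characteristic polynomial of [Amat n a]; its gradient vanishes because
   [grad 'X^N] is the combination of the [grad 'X^j] with coefficients [a 0 j]. *)
pose q := 'X^N - \sum_(j < N) a 0 j *: 'X^j.
have lt_q : (size (\sum_(j < N) a 0 j *: 'X^j)%R < N.+1)%N.
  have := size_poly N (fun j => a 0 (inord j)); rewrite poly_def ltnS.
  by under eq_bigr => j _ do rewrite inord_val.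
have size_q : size q = N.+1 by rewrite size_polyDl size_polyXn // size_polyN.
have q_monic : q \is monic.
  by rewrite monicE lead_coefDl ?size_polyXn ?size_polyN // lead_coefXn.
have grad_q : grad q = 0.
  rewrite /grad mom_gradD -scaleN1r mom_gradZ -/grad gradN gradJ scaleN1r.
  by apply/eqP; rewrite subr_eq0; apply/eqP; congr (grad _); apply: eq_bigr => j _; rewrite mxE.
have [t [ut st qE]] := mom_grad_simple_roots m0 Om size_rs rsE rs2 q_monic size_q grad_q.
exists t; split => //; apply/allP => z zt.
rewrite eigenvalue_root_char (@char_poly_companion _ N q) //.
  by rewrite qE root_prod_XsubC.
move=> i j; rewrite mxE /=; have : (i <= n.*2)%N by rewrite -ltnS ltn_ord.
have -> : - q`_j = a 0 j.
  rewrite coefB coefXn ltn_eqF // sub0r opprK coef_sum (bigD1 j) //=.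
  rewrite coefZ coefXn eqxx mulr1 big1 ?addr0 // => k kj.
  by rewrite coefZ coefXn -val_eqE eq_sym in kj *; rewrite (negPf kj) mulr0.
by case: ltngtP => //= lt_i _; rewrite eq_sym.
Qed.
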